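(* Let $K \geq 1$ be a real number and let $A \subseteq \mathbb{R}$ be a finite set of size $n$. Suppose that for each $a \in A$ we are given a map $\phi_a : A \to \mathbb{R}$ such that: (i) $\phi_a$ is injective; (ii) $\phi_a(a) = a$; (iii) $|a - \phi_a(x)| \leq \frac{1}{K}|a - x|$ for all $x \in A$; (iv) for every $x \in A$, $\phi_a(x)$ lies between $a$ and $x$ (i.e. in the closed interval with endpoints $a$ and $x$). Then \[ \Big|\bigcup_{a \in A} \phi_a(A)\Big| \geq \frac{1}{8} K n \left(1 - n^{-1/K^2}\right).\] *)

(* Defs.v *)
From mathcomp Require Import all_boot all_order all_algebra.
From mathcomp Require Import finmap.
From mathcomp Require Import reals exp.

(* Main.v *)
Require Import Defs.
From mathcomp Require Import all_boot all_order all_algebra.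
From mathcomp Require Import finmap.
From mathcomp Require Import reals sequences exp.
From mathcomp Require Import ring lra.

(** Let [A] have minimum [lo] and maximum [hi], and put [d := (hi - lo) / K], so
that every value [phi a x] lies within [d] of [a].  Consider the about [K / 5]
windows [[lo + 5 j d, lo + (5 j + 2) d]] inside [[lo, hi]].  If all of them meet
[A], one point chosen in each gives images [phi a A] that are pairwise disjoint,
hence about [K n / 5] values.  Otherwise some window is empty and cuts [A] into
nonempty parts [L] and [R], separated by a gap [(p, q)] longer than [2 d].  By
betweenness the values of [L] and of [R] stay in the respective hulls, whereas
[phi p R] and [phi q L] fill the gap with [|R| + |L| = n] further values.
Induction on [n] concludes, because splitting [n] costs the claimed bound at
most [n / (4 K)]. *)

Import Order.TTheory GRing.Theory Num.Theory.
Local Open Scope ring_scope.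
Set Implicit Arguments.
Unset Strict Implicit.

Section ContractingMaps.

Variable R : realType.
Implicit Types (K e x y : R) (s : seq R) (phi : R -> R -> R) (m n : nat).

(** * Analytic estimates for the bound *)

(** Write the two powers as [expR a] and [expR b], where [b <= a <= 0]. Then [expR a - expR b = expR
    a * (1 - expR (b - a)) <= a - b = e * ln (y / x)], and [ln u < u] finishes. *)
Lemma powRN_diff_le e x y : 0 <= e -> 1 <= x -> x <= y ->
  x * (x `^ (- e) - y `^ (- e)) <= e * y.
Proof.
move=> e0 x1 xy; have x0 : 0 < x by lra.
have y0 : 0 < y by lra.
rewrite /powR !gt_eqF //.
set a := - e * ln x; set b := - e * ln y.
have a0 : a <= 0 by rewrite /a mulNr oppr_le0 mulr_ge0 // ln_ge0.
have ba : a - b <= e * (y / x).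
  rewrite (_ : a - b = e * (ln y - ln x)); last by rewrite /a /b; ring.
  by rewrite -ln_div ?posrE // ler_wpM2l // ltW // ln_sublinear // divr_gt0.
have ba0 : 0 <= a - b.
  rewrite (_ : a - b = e * (ln y - ln x)); last by rewrite /a /b; ring.
  by rewrite mulr_ge0 // subr_ge0 ler_ln.
have ea : expR a <= 1 by rewrite expR_le1.
have eb : expR b = expR a * expR (b - a).
  by rewrite -expRD; congr expR; ring.
have h : expR a - expR b <= a - b.
  rewrite eb; have := expR_ge1Dx (b - a); have := expR_gt0 a.
  by nra.
apply: (@le_trans _ _ (x * (e * (y / x)))).
  by rewrite ler_wpM2l ?(ltW x0) // (le_trans h).
by rewrite le_eqVlt; apply/orP; left; apply/eqP; field; rewrite gt_eqF.
Qed.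

Definition growth_bound K n : R :=
  8^-1 * K * n%:R * (1 - n%:R `^ (- (K ^+ 2)^-1)).

Lemma growth_bound_le K n : 0 <= K -> growth_bound K n <= 8^-1 * K * n%:R.
Proof.
move=> K0; rewrite /growth_bound ler_piMr //.
  by rewrite !mulr_ge0 // invr_ge0.
by rewrite gerBl powR_ge0.
Qed.

(** The defect is [K / 8] times two differences controlled by [powRN_diff_le]. The exponent
    [e = K ^- 2] turns [K * e] into [K^-1 <= 1], so the defect is at most a quarter of [m + n]. The
    term [(m + n)%:R] is what the gap values will pay for. *)
Lemma growth_boundD K m n : 1 <= K -> (0 < m)%N -> (0 < n)%N ->
  growth_bound K (m + n) <= growth_bound K m + growth_bound K n + (m + n)%:R.
Proof.
move=> K1 m0 n0; rewrite /growth_bound natrD.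
have m1 : 1 <= m%:R :> R by rewrite ler1n.
have n1 : 1 <= n%:R :> R by rewrite ler1n.
set e := (K ^+ 2)^-1; set x : R := m%:R; set y : R := n%:R.
have K0 : 0 < K by lra.
have e0 : 0 <= e by rewrite invr_ge0 exprn_ge0 // ltW.
have [xxy yxy] : x <= x + y /\ y <= x + y by rewrite lerDl lerDr !ler0n.
have hm := powRN_diff_le e0 m1 xxy; have hn := powRN_diff_le e0 n1 yxy.
rewrite -/x -/y in m1 n1.
have Ke : K * e = K^-1 by rewrite /e; field; rewrite gt_eqF.
have Ki : K^-1 <= 1 by rewrite invf_le1.
have : K * (x * (x `^ (- e) - (x + y) `^ (- e)) +
            y * (y `^ (- e) - (x + y) `^ (- e)))
    <= K * (e * (x + y) + e * (x + y)) by rewrite ler_pM2l // lerD.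
have -> : K * (e * (x + y) + e * (x + y)) = 2 * K^-1 * (x + y) by rewrite -Ke; ring.
have : K^-1 * (x + y) <= 1 * (x + y) by rewrite ler_wpM2r //; lra.
lra.
Qed.

(** * Extrema and contracting families on finite sequences *)

Lemma seq_has_max s : s != [::] ->
  exists2 p, p \in s & {in s, forall x, x <= p}.
Proof.
elim: s => // x s IH _; have [->|/IH [p ps pP]] := eqVneq s [::].
  by exists x; rewrite ?mem_head // => y; rewrite inE => /eqP ->.
have [xp|px] := leP x p.
  exists p; first by rewrite inE ps orbT.
  by move=> y; rewrite inE => /predU1P [->|/pP].
exists x; first exact: mem_head.
by move=> y; rewrite inE => /predU1P [->//|/pP yp]; apply: le_trans yp (ltW px).
Qed.

Lemma seq_has_min s : s != [::] ->
  exists2 p, p \in s & {in s, forall x, p <= x}.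
Proof.
move=> s0; have [|p] := @seq_has_max [seq - x | x <- s]; first by case: s s0.
case/mapP=> q qs -> qP; exists q => // x xs.
by rewrite -lerN2; apply: qP; apply: map_f.
Qed.

(** The maps are total and the conditions concern members of [s] only, so the same [phi] serves for
    every subsequence met in the induction. *)
Record contracting K phi s : Prop := Contracting {
  contr_inj : {in s, forall a, {in s &, injective (phi a)}};
  contr_fix : {in s, forall a, phi a a = a};
  contr_le : {in s &, forall a x, `|a - phi a x| <= K^-1 * `|a - x|};
  contr_between : {in s &, forall a x,
    Num.min a x <= phi a x <= Num.max a x} }.

Lemma sub_contracting K phi s t :
  {subset s <= t} -> contracting K phi t -> contracting K phi s.
Proof.
move=> st [h1 h2 h3 h4]; split.
- by move=> a /st ta x y /st tx /st ty; apply: h1.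
- by move=> a /st; apply: h2.
- by move=> a x /st ta /st; apply: h3.
- by move=> a x /st ta /st; apply: h4.
Qed.

Definition contr_values phi s := undup [seq phi a x | a <- s, x <- s].

Lemma mem_contr_values phi s y : y \in contr_values phi s ->
  exists a x, [/\ a \in s, x \in s & y = phi a x].
Proof. by rewrite mem_undup => /allpairsP [[a x] /= [? ? ->]]; exists a, x. Qed.

Lemma contr_values_f phi s a x :
  a \in s -> x \in s -> phi a x \in contr_values phi s.
Proof. by move=> *; rewrite mem_undup allpairs_f. Qed.

Lemma sub_contr_values phi s t :
  {subset s <= t} -> {subset contr_values phi s <= contr_values phi t}.
Proof.
by move=> st y /mem_contr_values [a [x [/st ? /st ? ->]]]; apply: contr_values_f.
Qed.

(** * Counting values at the scale of the diameter *)

Section Diameter.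

Variables (K : R) (phi : R -> R -> R) (s : seq R) (lo hi : R).
Hypotheses (K1 : 1 <= K) (s_uniq : uniq s) (phiP : contracting K phi s).
Hypotheses (slo : {in s, forall x, lo <= x}) (shi : {in s, forall x, x <= hi}).

Let d := (hi - lo) / K.

Lemma contr_near a x : a \in s -> x \in s -> a - d <= phi a x <= a + d.
Proof.
move=> sa sx; have K0 : 0 < K by apply: lt_le_trans K1.
have : `|a - phi a x| <= d.
  apply: le_trans (contr_le phiP sa sx) _.
  rewrite /d mulrC ler_wpM2r ?invr_ge0 ?(ltW K0) // ler_norml.
  have [? ?] := (slo sa, slo sx); have [? ?] := (shi sa, shi sx).
  by apply/andP; split; lra.
by rewrite ler_norml => /andP [? ?]; apply/andP; split; lra.
Qed.

(** Each image [phi (c i) s] lies within [d] of [c i], so centres more than [2 * d] apart have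
    disjoint images, and injectivity gives each image [size s] elements. *)
Lemma separated_values m (c : nat -> R) :
  (forall i, (i < m)%N -> c i \in s) ->
  (forall i j, (i < j)%N -> (j < m)%N -> c i + 2 * d < c j) ->
  (m * size s <= size (contr_values phi s))%N.
Proof.
move=> cs csep.
have sep i j x y : (i < j)%N -> (j < m)%N -> x \in s -> y \in s ->
    phi (c i) x < phi (c j) y.
  move=> ij jm sx sy; have im := ltn_trans ij jm.
  have := (csep _ _ ij jm, contr_near (cs _ im) sx, contr_near (cs _ jm) sy).
  by case=> -[?] /andP [? ?] /andP [? ?]; lra.
rewrite -{1}(size_iota 0 m) -(size_allpairs (fun i x => phi (c i) x)).
apply: uniq_leq_size.
  apply: allpairs_uniq; rewrite ?iota_uniq // => -[i x] [j y].
  case/allpairsP=> -[i' x'] /= [im sx [-> ->]].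
  case/allpairsP=> -[j' y'] /= [jm sy [-> ->]].
  rewrite !mem_iota /= !add0n in im jm; rewrite /uncurry /= => E.
  case: (ltngtP i' j') => ij.
  - by have := sep _ _ _ _ ij jm sx sy; rewrite E ltxx.
  - by have := sep _ _ _ _ ij im sy sx; rewrite E ltxx.
  by rewrite -ij in E *; rewrite (contr_inj phiP (cs _ im) sx sy E).
move=> y /allpairsP [[i x] /= [im sx ->]].
by rewrite contr_values_f // cs //; move: im; rewrite mem_iota.
Qed.

(** With [p] the maximum of [l] and [q] the minimum of [r], four blocks follow one another on the
    line: values of [l] up to [p], then [phi p r] in [(p, p + d]], then [phi q l] in [[q - d, q)],
    then values of [r] from [q] on. The middle two are disjoint because [p + 2 * d < q]. *)
Lemma gap_values t :
  let l := [seq x <- s | x < t] in let r := [seq x <- s | t + 2 * d < x] in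
  l != [::] -> r != [::] -> {in s, forall x, (x < t) || (t + 2 * d < x)} ->
  (size (contr_values phi l) + size (contr_values phi r) + (size l + size r)
     <= size (contr_values phi s))%N.
Proof.
move=> l r l0 r0 lr.
have [p pl pmax] := seq_has_max l0; have [q qr qmin] := seq_has_min r0.
have ls : {subset l <= s} by move=> x; rewrite mem_filter => /andP [].
have rs : {subset r <= s} by move=> x; rewrite mem_filter => /andP [].
have pt : p < t by move: pl; rewrite mem_filter => /andP [].
have tq : t + 2 * d < q by move: qr; rewrite mem_filter => /andP [].
have [sp sq] := (ls _ pl, rs _ qr).
have d0 : 0 <= d.
  rewrite divr_ge0 ?subr_ge0 ?(le_trans (slo sp) (shi sp)) //.
  exact: le_trans K1.
have Vl y : y \in contr_values phi l -> y <= p.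
  case/mem_contr_values=> a [x [la lx ->]].
  have /andP [_ h] := contr_between phiP (ls _ la) (ls _ lx).
  by apply: le_trans h _; rewrite ge_max !pmax.
have Vr y : y \in contr_values phi r -> q <= y.
  case/mem_contr_values=> a [x [la lx ->]].
  have /andP [h _] := contr_between phiP (rs _ la) (rs _ lx).
  by apply: le_trans _ h; rewrite le_min !qmin.
have Wr y : y \in map (phi p) r -> p < y <= p + d.
  case/mapP=> x rx ->; have /andP [_ ->] := contr_near sp (rs _ rx).
  have qx := qmin _ rx; have px : p < x by lra.
  have /andP [h _] := contr_between phiP sp (rs _ rx).
  rewrite andbT lt_neqAle (le_trans _ h) ?le_min ?lexx ?(ltW px) // andbT.
  (* Strictness: [p] is already the image of [p] under [phi p], so by injectivity no [x] in [r] is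
     sent to it. *)
  apply/eqP; rewrite -{1}(contr_fix phiP sp) => /(contr_inj phiP sp sp (rs _ rx)).
  by move=> E; rewrite E ltxx in px.
have Wl y : y \in map (phi q) l -> q - d <= y < q.
  case/mapP=> x lx ->; have /andP [-> _] := contr_near sq (ls _ lx).
  have xp := pmax _ lx; have xq : x < q by lra.
  have /andP [_ h] := contr_between phiP sq (ls _ lx).
  rewrite /= lt_neqAle (le_trans h) ?ge_max ?lexx ?(ltW xq) // andbT.
  apply/eqP; rewrite -{2}(contr_fix phiP sq) => /(contr_inj phiP sq (ls _ lx) sq).
  by move=> E; rewrite E ltxx in xq.
have -> : (size (contr_values phi l) + size (contr_values phi r) +
    (size l + size r) = size (contr_values phi l ++ map (phi p) r ++
       map (phi q) l ++ contr_values phi r))%N.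
  by rewrite !size_cat !size_map -!addnA; congr addn; rewrite addnC -addnA addnCA.
apply: uniq_leq_size.
  rewrite !cat_uniq !has_cat !negb_or !undup_uniq /=.
  rewrite !map_inj_in_uniq ?filter_uniq ?andbT //=; last 2 first.
  - by move=> x y /ls sx /ls sy; apply: (contr_inj phiP).
  - by move=> x y /rs sx /rs sy; apply: (contr_inj phiP).
  do ![apply/andP; split]; apply/hasPn=> y.
  - by move/Wr=> /andP [? ?]; apply/negP => /Vl; lra.
  - by move/Wl=> /andP [? ?]; apply/negP => /Vl; lra.
  - by move/Vr=> ?; apply/negP => /Vl; lra.
  - by move/Wl=> /andP [? ?]; apply/negP => /Wr; lra.
  - by move/Vr=> ?; apply/negP => /Wr; lra.
  - by move/Vr=> ?; apply/negP => /Wl; lra.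
move=> y; rewrite !mem_cat => /or4P [].
- exact: sub_contr_values.
- by case/mapP=> x /rs sx ->; apply: contr_values_f.
- by case/mapP=> x /ls sx ->; apply: contr_values_f.
- exact: sub_contr_values.
Qed.

End Diameter.

(** * Induction on the size *)

Theorem growth_bound_values K phi s : 1 <= K -> uniq s ->
  contracting K phi s -> growth_bound K (size s) <= (size (contr_values phi s))%:R.
Proof.
move=> K1; have K0 : 0 < K by lra.
have [n] := ubnP (size s); elim: n s => // n IH s; rewrite ltnS => sn us phiP.
have [s1|s2] := leqP (size s) 1.
  (* The bound vanishes at sizes 0 and 1. *)
  apply: le_trans (ler0n _ _); rewrite /growth_bound.
  by case: (size s) s1 => [|[|]] // _; rewrite ?mulr0 ?mul0r // powR1 subrr mulr0.
have s0 : s != [::] by case: s s2 {sn us phiP}.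
have [lo slo loP] := seq_has_min s0; have [hi shi hiP] := seq_has_max s0.
set d := (hi - lo) / K.
have lohi : lo <= hi by exact: loP.
have d0 : 0 <= d by rewrite divr_ge0 ?subr_ge0 // ltW.
have lohid : lo < hi.
  rewrite lt_neqAle lohi andbT; apply/eqP => E.
  have : (size s <= size [:: lo])%N.
    apply: uniq_leq_size => // x sx; rewrite inE eq_le loP // andbT.
    by rewrite E hiP.
  by rewrite leqNgt s2.
have dpos : 0 < d by rewrite divr_gt0 ?subr_gt0.
have Kd : K * d = hi - lo by rewrite /d; field; rewrite gt_eqF.
(* Windows of length [2 * d] start [5 * d] apart, so points of distinct windows are at least
   [3 * d > 2 * d] apart. There are [m + 1] of them, where [m <= K / 5 < m + 1]: enough to beat
   [K / 8], while each still starts at or before [hi]. *)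
have /Num.Theory.truncn_itv /andP [mK Km] : 0 <= K / 5 by rewrite divr_ge0 // ltW.
set m := Num.Def.trunc (K / 5) in mK Km.
pose t j : R := lo + 5 * d * j%:R.
pose P j := [pred x | t j <= x <= t j + 2 * d].
have [/forallP hit|/forallPn [j gap]] := boolP [forall j : 'I_m.+1, has (P j) s].
  have hitP i : (i < m.+1)%N -> has (P i) s by move=> im; apply: (hit (Ordinal im)).
  have : (m.+1 * size s <= size (contr_values phi s))%N.
    apply: (@separated_values K phi s lo hi K1 us phiP loP hiP m.+1
      (fun i => nth 0 s (find (P i) s))).
      by move=> i im; rewrite mem_nth // -has_find hitP.
    move=> i j ij jm.
    have /= /andP [_ hi1] := nth_find 0 (hitP i (ltn_trans ij jm)).
    have /= /andP [hj1 _] := nth_find 0 (hitP j jm).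
    have ij1 : i%:R + 1 <= j%:R :> R by rewrite natr1 ler_nat.
    have : d * (i%:R + 1) <= d * j%:R by rewrite ler_wpM2l.
    by rewrite /t in hi1 hj1; rewrite -/d; lra.
  rewrite -(ler_nat R) natrM => h; apply: le_trans (growth_bound_le _ _) _.
    exact: ltW.
  apply: le_trans h; rewrite ler_wpM2r //; lra.
have jK : 5 * j%:R <= K.
  have : j%:R <= m%:R :> R by rewrite ler_nat -ltnS.
  lra.
have thi : t j <= hi.
  have : d * (5 * j%:R) <= d * K by rewrite ler_wpM2l.
  by rewrite /t; lra.
have tlo : lo <= t j by rewrite /t lerDl mulr_ge0 // mulr_ge0.
have lr : {in s, forall x, (x < t j) || (t j + 2 * d < x)}.
  by move=> x sx; have /hasPn /(_ _ sx) := gap; rewrite /= negb_and -!ltNge.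
set l := [seq x <- s | x < t j]; set r := [seq x <- s | t j + 2 * d < x].
(* The empty window starts between [lo] and [hi] and contains neither. Hence [lo] lies below it and
   [hi] above it, even for a last window that could have overrun [hi]. *)
have ll : lo \in l.
  by rewrite mem_filter slo andbT; have /orP [//|] := lr _ slo; lra.
have rh : hi \in r.
  by rewrite mem_filter shi andbT; have /orP [|//] := lr _ shi; lra.
have sE : size s = (size l + size r)%N.
  rewrite !size_filter -(count_predC (fun x => x < t j)); congr addn.
  apply: eq_in_count => x sx /=; have := lr _ sx.
  by case: (ltP x (t j)) => //= xt _; apply/esym/negbTE; rewrite -leNgt; lra.
have l1 : (0 < size l)%N by case: (l) ll.
have r1 : (0 < size r)%N by case: (r) rh.
have ln0 : l != [::] by rewrite -size_eq0 -lt0n.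
have rn0 : r != [::] by rewrite -size_eq0 -lt0n.
have := @gap_values K phi s lo hi K1 us phiP loP hiP (t j) ln0 rn0 lr.
rewrite -(ler_nat R) -/d -/l -/r => gain; apply: le_trans gain.
rewrite sE; apply: le_trans (growth_boundD K1 l1 r1) _.
have ln : (size l < n)%N by apply: leq_trans sn; rewrite sE -addn1 leq_add2l.
have rn : (size r < n)%N by apply: leq_trans sn; rewrite sE -add1n leq_add2r.
(* The [size l + size r] gap values cancel the splitting loss exactly, leaving the two induction
   hypotheses. *)
rewrite [leRHS]natrD lerD2r natrD lerD // IH ?filter_uniq //.
- by apply: sub_contracting phiP => x; rewrite mem_filter => /andP [].
- by apply: sub_contracting phiP => x; rewrite mem_filter => /andP [].
Qed.

End ContractingMaps.

(** * Transfer to finite sets *)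

Unset Implicit Arguments.
Set Strict Implicit.
Local Open Scope fset_scope.

Theorem theorem1p1 (R : realType) (K : R) (hK : 1 <= K)
    (n : nat) (A : {fset R}) (hA : #|` A| = n)
    (phi : A -> A -> R)
    (phi_inj : forall a : A, injective (phi a))
    (phi_fix : forall a : A, phi a a = val a)
    (phi_contr : forall a x : A,
       `|val a - phi a x| <= K^-1 * `|val a - val x|)
    (phi_between : forall a x : A,
       Num.min (val a) (val x) <= phi a x <= Num.max (val a) (val x)) :
  8^-1 * K * n%:R * (1 - n%:R `^ (- (K ^+ 2)^-1))
    <= #|` (\bigcup_(a in {: A}) [fset phi a x | x : A])%fset |%:R.
Proof.
(* Extend [phi] from the subtype [A] to all reals, with the junk value 0 off [A], which is never
   evaluated on members of [A]. *)
pose f (a x : R) : R :=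
  if (insub a : option A, insub x : option A) is (Some a', Some x')
  then phi a' x' else 0.
have fE (a x : A) : f (val a) (val x) = phi a x by rewrite /f !valK.
have fP : contracting K f A.
  split.
  - move=> a aA x y xA yA; rewrite -[a]/(val [` aA]) -[x]/(val [` xA]).
    by rewrite -[y]/(val [` yA]) !fE => /phi_inj ->.
  - by move=> a aA; rewrite -[a]/(val [` aA]) fE phi_fix.
  - move=> a x aA xA; rewrite -[a]/(val [` aA]) -[x]/(val [` xA]) fE.
    exact: phi_contr.
  - move=> a x aA xA; rewrite -[a]/(val [` aA]) -[x]/(val [` xA]) fE.
    exact: phi_between.
rewrite -hA; apply: le_trans (growth_bound_values hK (fset_uniq A) fP) _.
rewrite ler_nat; apply: uniq_leq_size; first exact: undup_uniq.
move=> y /mem_contr_values [a [x [aA xA ->]]].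
rewrite -[a]/(val [` aA]) -[x]/(val [` xA]) fE.
apply/bigfcupP; exists [` aA]; first by rewrite mem_index_enum.
by apply/imfsetP; exists [` xA].
Qed.
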